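(* For all real numbers $x, y > 0$, $\log(xy) = \log(x) + \log(y)$, where $\log(x) := \int_1^x \frac{dt}{t}$.
   Context: For $x>0$ the natural logarithm is defined as the Riemann integral $\log(x) := \int_1^x \frac{dt}{t}$, with the convention $\int_a^b f(t)\,dt = -\int_b^a f(t)\,dt$ when $a > b$ and $\int_a^a f(t)\,dt = 0$. *)

(* Defs.v *)
From Stdlib Require Import Reals.
From Coquelicot Require Import Coquelicot.
Open Scope R_scope.

(* [RInt] is Coquelicot's oriented Riemann integral: its Riemann sums carry
   the sign of the upper bound minus the lower bound, so that
   [RInt f a b = - RInt f b a] for integrable [f], and [RInt f a a = 0].
   The value is meaningful only for [0 < x], where the integrand is
   continuous between [1] and [x]. *)
Definition log (x : R) : R := RInt (fun t : R => 1 / t) 1 x.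

(* Main.v *)
(* Split [1, xy] at x; the substitution t = x u turns the integral over [x, xy]
   into the integral over [1, y], because dt/t is invariant under dilation. *)
Require Import Defs.
From Stdlib Require Import Reals Lra.
From Coquelicot Require Import Coquelicot.
Open Scope R_scope.

(** By dilation invariance of dt/t ([RInt_inv_dilation]), log y is also the integral from x to xy,
    which continues the one from 1 to x. *)

Lemma ex_RInt_inv (a b : R) (ha : 0 < a) (hb : 0 < b) :
  ex_RInt (fun t : R => 1 / t) a b.
Proof.
  apply (@ex_RInt_continuous R_CompleteNormedModule).
  intros z [hz _].
  (* Whatever the order of [a] and [b], this keeps [z] away from the pole at 0. *)
  assert (0 < Rmin a b) by now apply Rmin_glb_lt.
  apply (@ex_derive_continuous R_AbsRing R_NormedModule).
  auto_derive; lra.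
Qed.

Lemma RInt_inv_dilation (c a b : R) (hc : 0 < c) (ha : 0 < a) (hb : 0 < b) :
  RInt (fun t : R => 1 / t) (c * a) (c * b) = RInt (fun t : R => 1 / t) a b.
Proof.
  (* The zero shift gives the bounds the affine form that [RInt_comp_lin] expects. *)
  rewrite <- (Rplus_0_r (c * a)), <- (Rplus_0_r (c * b)).
  rewrite <- (@RInt_comp_lin R_CompleteNormedModule).
  - apply RInt_ext.
    intros u [hu _].
    assert (0 < Rmin a b) by now apply Rmin_glb_lt.
    change (c * (1 / (c * u + 0)) = 1 / u).
    field; lra.
  - rewrite !Rplus_0_r.
    apply ex_RInt_inv; now apply Rmult_lt_0_compat.
Qed.

Theorem theorem3p3 (x y : R) (hx : 0 < x) (hy : 0 < y) :
  log (x * y) = log x + log y.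
Proof.
  unfold log.
  (* Now log y runs from [x] to [x * y], adjacent to log x. *)
  rewrite <- (RInt_inv_dilation x 1 y hx Rlt_0_1 hy), Rmult_1_r.
  symmetry.
  apply (@RInt_Chasles R_CompleteNormedModule); apply ex_RInt_inv;
    try apply Rmult_lt_0_compat; lra.
Qed.
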